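(* Assume that $P_X\ll\nu$, where $\nu(dx)=\nu_1(dx_1)\otimes\cdots\otimes\nu_p(dx_p)$, and that there exist $M_1,M_2>0$ such that $$M_1\le p_X\le M_2\qquad \nu\text{-a.e.}$$ Then there exists $0<M\le 1$ such that for every $u\subseteq\{1,\dots,p\}$, $$p_X\ge M\,p_{X_u}p_{X_{u^c}}\qquad \nu\text{-a.e.}$$
   Context: $\mathbf X=(X_1,\dots,X_p)$ is a random vector in $\mathbb R^p$, $p\ge1$, with law $P_X$; $\nu$ is a $\sigma$-finite measure on $(\mathbb R^p,\mathcal B(\mathbb R^p))$ and $p_X=dP_X/d\nu$. For $u\subseteq\{1,\dots,p\}$, $X_u=(X_l)_{l\in u}$, $u^c$ is the complement of $u$ in $\{1,\dots,p\}$, and $p_{X_u}$ is the marginal density of $X_u$ with respect to $\bigotimes_{l\in u}\nu_l$ (with $p_{X_\emptyset}=1$). *)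

(* Defs.v *)
From HB Require Import structures.
From mathcomp Require Import all_boot all_order all_algebra.
From mathcomp Require Import all_classical all_reals all_analysis.

Set Implicit Arguments.
Unset Strict Implicit.
Unset Printing Implicit Defensive.

Import Order.TTheory GRing.Theory Num.Theory.
Import numFieldNormedType.Exports.

Local Open Scope classical_set_scope.
Local Open Scope ring_scope.
Local Open Scope ereal_scope.
Local Open Scope charge_scope.

Section product_measure_cons.
Context {d : measure_display} {T : measurableType d} {R : realType} {n : nat}.

Definition tuple_cons (xt : T * n.-tuple T) : n.+1.-tuple T :=
  [tuple of xt.1 :: xt.2].

Lemma measurable_tuple_cons : measurable_fun setT tuple_cons.
Proof. exact: measurable_cons. Qed.

HB.instance Definition _ :=
  isMeasurableFun.Build _ _ _ _ tuple_cons measurable_tuple_cons.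

Lemma tuple_consK :
  cancel tuple_cons (fun t => (thead t, [tuple of behead t])).
Proof. by move=> [x t]; congr pair; apply: val_inj. Qed.

Lemma measurable_tuple_uncons :
  measurable_fun setT
    (fun t : n.+1.-tuple T => (thead t, [tuple of behead t] : n.-tuple T)).
Proof.
apply: measurable_fun_pair; first exact: measurable_tnth.
exact: measurable_behead.
Qed.

Variables (m1 : {sigma_finite_measure set T -> \bar R})
  (m2 : {sigma_finite_measure set (n.-tuple T) -> \bar R}).

Definition product_measure_cons : set (n.+1.-tuple T) -> \bar R :=
  pushforward (m1 \x m2) tuple_cons.

Let product_measure_cons0 : product_measure_cons set0 = 0.
Proof. exact: measure0. Qed.

Let product_measure_cons_ge0 A : 0 <= product_measure_cons A.
Proof. exact: measure_ge0. Qed.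

Let product_measure_cons_sigma_additive :
  semi_sigma_additive product_measure_cons.
Proof. exact: measure_semi_sigma_additive. Qed.

HB.instance Definition _ := isMeasure.Build _ _ _ product_measure_cons
  product_measure_cons0 product_measure_cons_ge0
  product_measure_cons_sigma_additive.

Let product_measure_cons_sigma_finite : sigma_finite setT product_measure_cons.
Proof.
pose uncons (t : n.+1.-tuple T) := (thead t, [tuple of behead t] : n.-tuple T).
have /sigma_finiteP[F [FT ndF Foo]] := sigma_finiteT m1.
have /sigma_finiteP[G [GT ndG Goo]] := sigma_finiteT m2.
exists (fun k => uncons @^-1` (F k `*` G k)).
  apply/seteqP; split => // t _.
  have [i _ Fi] : (\bigcup_i F i) (thead t) by rewrite -FT.
  have [j _ Gj] : (\bigcup_j G j) [tuple of behead t] by rewrite -GT.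
  exists (maxn i j) => //; split.
  - exact: (subsetPset _ _ (ndF _ _ (leq_maxl i j))).
  - exact: (subsetPset _ _ (ndG _ _ (leq_maxr i j))).
move=> k; have [mF Fk] := Foo k; have [mG Gk] := Goo k; split.
  by rewrite -[X in measurable X]setTI;
    apply: measurable_tuple_uncons => //; exact: measurableX.
rewrite /product_measure_cons /pushforward.
rewrite (_ : _ @^-1` _ = F k `*` G k); last first.
  by apply/funext => xt; exact: (congr1 (F k `*` G k) (tuple_consK xt)).
by rewrite product_measure1E// lte_mul_pinfty// ge0_fin_numE.
Qed.

HB.instance Definition _ := Measure_isSigmaFinite.Build _ _ _
  product_measure_cons product_measure_cons_sigma_finite.

End product_measure_cons.

(* The product measure nu_0 \otimes ... \otimes nu_(n-1) on n.-tuple T, with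
   its product sigma-algebra; for n = 0 it is the unit mass at the empty
   tuple. *)
Fixpoint product_measure_tuple {d : measure_display} {T : measurableType d}
    {R : realType} (n : nat) :
    ('I_n -> {sigma_finite_measure set T -> \bar R}) ->
    {sigma_finite_measure set (n.-tuple T) -> \bar R} :=
  match n with
  | 0 => fun _ => \d_[tuple]
  | n'.+1 => fun nu => product_measure_cons (nu ord0)
      (product_measure_tuple (fun i : 'I_n' => nu (lift ord0 i)))
  end.

Lemma product_measure_tupleE {d : measure_display} {T : measurableType d}
    {R : realType} (n : nat)
    (nu : 'I_n -> {sigma_finite_measure set T -> \bar R}) (A : 'I_n -> set T) :
  (forall i, measurable (A i)) ->
  product_measure_tuple nu [set t | forall i, A i (tnth t i)] =
  \prod_(i < n) nu i (A i).
Proof.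
elim: n nu A => [|n IHn] nu A mA.
  by rewrite big_ord0 /= diracE mem_set// => -[].
rewrite big_ord_recl -IHn//= /product_measure_cons /pushforward.
rewrite -product_measure1E//; last first.
  rewrite (_ : mkset _ = \bigcap_(i in setT) ((@tnth n T)^~ i @^-1` A (lift ord0 i))).
    apply: fin_bigcap_measurable => // i _.
    by rewrite -[X in measurable X]setTI; exact: measurable_tnth.
  by apply/seteqP; split => t /= h i; [move=> _|]; exact: h.
congr (_ _); apply/seteqP; split => -[x t] /= => [h|[h0 h] i].
  split=> [|i]; first exact: (h ord0).
  by have := h (lift ord0 i); rewrite tnthS.
by case: (unliftP ord0 i) => [j ->|->//]; rewrite tnthS; exact: h.
Qed.

Section coordinates.
Context {d : measure_display} {T : measurableType d} {p : nat}.

(* x_u = (x_l)_(l in u), listed in increasing order of the indices l. *)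
Definition coords (u : {set 'I_p}) (x : p.-tuple T) : #|u|.-tuple T :=
  [tuple tnth x (enum_val i) | i < #|u|].

Lemma measurable_coords (u : {set 'I_p}) : measurable_fun setT (coords u).
Proof.
apply/measurable_fun_tnthP => i.
rewrite (_ : _ \o _ = @tnth _ T ^~ (enum_val i)); first exact: measurable_tnth.
by apply/funext => x /=; rewrite tnth_mktuple.
Qed.

HB.instance Definition _ (u : {set 'I_p}) :=
  isMeasurableFun.Build _ _ _ _ (coords u) (@measurable_coords u).

End coordinates.

Definition density {d : measure_display} {T : measurableType d} {R : realType}
    (Q : probability T R) (mu : {sigma_finite_measure set T -> \bar R}) :
    T -> \bar R :=
  'd (charge_of_finite_measure Q) '/d mu.

Lemma density_tuple0 {d : measure_display} {T : measurableType d}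
    {R : realType} (n : nat) (nu : 'I_n -> {sigma_finite_measure set T -> \bar R})
    (Q : probability (n.-tuple T) R) (x : n.-tuple T) :
  n = 0%N -> density Q (product_measure_tuple nu) x = 1.
Proof.
move=> n0; subst n.
have dom : charge_of_finite_measure Q `<< product_measure_tuple nu.
  move=> A nA B mB BA; have := nA B mB BA; rewrite /= diracE.
  case: (boolP (_ \in B)) => [_ /eqP|/negP B0 _]; first by rewrite eqe oner_eq0.
  rewrite (_ : B = set0) ?measure0//; apply/seteqP; split => // y By.
  by exfalso; apply: B0; rewrite -(tuple0 y) mem_set.
have := Radon_Nikodym_integral dom (@measurableT _ _).
rewrite /= integral_dirac//.
by rewrite diracT mul1e (tuple0 x) /density => <-; exact: probability_setT.
Qed.

Section marginals.
Context {d : measure_display} {Omega : measurableType d} {R : realType}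
  {P : probability Omega R} {p : nat}.

Definition subvector (X : {RV P >-> p.-tuple (measurableTypeR R)})
    (u : {set 'I_p}) : {RV P >-> #|u|.-tuple (measurableTypeR R)} :=
  coords u \o X.

Definition marginal_measure
    (nu : 'I_p -> {sigma_finite_measure set (measurableTypeR R) -> \bar R})
    (u : {set 'I_p}) :
    {sigma_finite_measure set (#|u|.-tuple (measurableTypeR R)) -> \bar R} :=
  product_measure_tuple (fun i : 'I_#|u| => nu (enum_val i)).

Definition marginal_density (X : {RV P >-> p.-tuple (measurableTypeR R)})
    (nu : 'I_p -> {sigma_finite_measure set (measurableTypeR R) -> \bar R})
    (u : {set 'I_p}) : #|u|.-tuple (measurableTypeR R) -> \bar R :=
  density (distribution P (subvector X u)) (marginal_measure nu u).

End marginals.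

Arguments marginal_density {d Omega R P p} X nu u _.

Lemma marginal_density0 {d : measure_display} {Omega : measurableType d}
    {R : realType} {P : probability Omega R} {p : nat}
    (X : {RV P >-> p.-tuple (measurableTypeR R)})
    (nu : 'I_p -> {sigma_finite_measure set (measurableTypeR R) -> \bar R}) x :
  marginal_density X nu finset.set0 x = 1.
Proof. by apply: density_tuple0; rewrite cards0. Qed.

(* Main.v *)
Require Import Defs.
From HB Require Import structures.
From mathcomp Require Import all_boot all_order all_algebra.
From mathcomp Require Import all_classical all_reals all_analysis.
From mathcomp Require Import measurable_realfun.

(** The lower bound on the density forces the reference measure to be finite:
    integrating [M1 <= pX] gives [M1 * nu setT <= 1]. It is also nonzero, since
    it dominates a probability, so each factor of [nu] has finite mass and the
    total mass [V = nu setT] is a positive real number that splits as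
    [V = V_u * V_(~: u)], where [V_w] is the product of the masses of the
    factors indexed by [w].

    The upper bound says that the law of [X] is at most [M2 * nu] as a measure.
    Projecting onto the coordinates in [u] sends [nu] to [V_(~: u)] times the
    product of the factors in [u] ([product_measure_coords]), so the law of
    [X_u] is at most [M2 * V_(~: u)] times its reference measure, and the
    marginal density is almost everywhere at most [M2 * V_(~: u)]
    ([marginal_density_bounds]). Multiplying the bounds for [u] and [~: u] shows
    that the product of the two marginal densities is at most [M2 ^+ 2 * V],
    whatever [u] is. As [M1 <= pX], the constant [M1 / (M2 ^+ 2 * V)], capped at
    [1], works for every [u].

    The Radon-Nikodym derivative is only determined up to null sets, and it may
    take negative values there; this is why each upper bound on a density comes
    with nonnegativity, without which the bounds could not be multiplied. *)

Import Order.TTheory GRing.Theory Num.Theory.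
Import numFieldNormedType.Exports.

Local Open Scope classical_set_scope.
Local Open Scope ring_scope.
Local Open Scope ereal_scope.

(** * Pointwise bounds on densities and bounds on measures *)

(** On the set [E] where [g < f], the two integrals over any part of [E] are
    equal, so [f] and [g] agree almost everywhere on [E], and [E] is null. *)
Lemma le_integral_ae_le {d : measure_display} {T : measurableType d}
    {R : realType} {mu : {measure set T -> \bar R}} (f g : T -> \bar R) :
  mu.-integrable setT f -> mu.-integrable setT g ->
  (forall A, measurable A -> \int[mu]_(x in A) f x <= \int[mu]_(x in A) g x) ->
  {ae mu, forall x, f x <= g x}.
Proof.
move=> intf intg fg.
have mf := measurable_int _ intf; have mg := measurable_int _ intg.
pose E := [set x | g x < f x].
have mE : measurable E by rewrite -[E]setTI; exact: measurable_lte.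
have fgE : ae_eq mu E f g.
  apply: integral_ae_eq => //.
  - exact: integrableS intf.
  - exact: measurable_funS mg.
  move=> A AE mA; apply/eqP; rewrite eq_le fg//=.
  apply: le_integral => //; [exact: integrableS intg|exact: integrableS intf|].
  by move=> x /set_mem /AE /ltW.
apply: filterS fgE => x /= Efg; rewrite leNgt; apply/negP => gf.
by move: (gf); rewrite Efg// ltxx.
Qed.

Lemma integral_density {d : measure_display} {T : measurableType d}
    {R : realType} {Q : probability T R}
    {mu : {sigma_finite_measure set T -> \bar R}} (A : set T) :
  Q `<< mu -> measurable A -> \int[mu]_(x in A) density Q mu x = Q A.
Proof. by move=> dom mA; rewrite -Radon_Nikodym_integral. Qed.

(** The a.e. comparison of integrals of nonnegative functions asks for
    nonnegativity everywhere, hence the passage through the absolute value of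
    the density. *)
Lemma probability_le_of_density_le {d : measure_display} {T : measurableType d}
    {R : realType} (Q : probability T R)
    (mu : {sigma_finite_measure set T -> \bar R}) (c : R) :
  Q `<< mu -> (0 <= c)%R ->
  {ae mu, forall x, 0 <= density Q mu x <= c%:E} ->
  forall A, measurable A -> Q A <= c%:E * mu A.
Proof.
move=> dom c0 fc A mA; rewrite -(integral_density A dom mA) -integral_cst//.
have intf : mu.-integrable setT (density Q mu) by exact: Radon_Nikodym_integrable.
have mf := measurable_funS measurableT (@subsetT _ A) (measurable_int mu intf).
apply: le_trans (le_trans (lee_abs _) (le_abse_integral _ _ _)) _ => //.
apply: ae_ge0_le_integral => //; first exact: measurableT_comp.
by apply: filterS fc => x /andP[f0 fc] _; rewrite gee0_abs.
Qed.

(** A density is integrable, and a positive constant is integrable only for a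
    finite measure. *)
Lemma density_bounded_below_lty {d : measure_display} {T : measurableType d}
    {R : realType} (Q : probability T R)
    (mu : {sigma_finite_measure set T -> \bar R}) (c : R) :
  Q `<< mu -> (0 < c)%R ->
  {ae mu, forall x, c%:E <= density Q mu x} -> mu setT < +oo.
Proof.
move=> dom c0 fc.
have intf : mu.-integrable setT (density Q mu) by exact: Radon_Nikodym_integrable.
have mf := measurable_int _ intf.
have : c%:E * mu setT < +oo.
  have /integrableP[_] := intf; apply: le_lt_trans.
  rewrite -integral_cst//; apply: ae_ge0_le_integral => //.
  - by move=> x _; rewrite lee_fin ltW.
  - exact: measurableT_comp.
  - by apply: filterS fc => x cf _; exact: le_trans cf (lee_abs _).
by rewrite !ltey; apply: contra => /eqP ->; rewrite gt0_muley// lte_fin.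
Qed.

(** Finiteness of [mu] makes the constant [c] integrable, so that both bounds
    are instances of [le_integral_ae_le]. Domination follows from the bound on
    [Q]. *)
Lemma ae_density_bounds {d : measure_display} {T : measurableType d}
    {R : realType} (Q : probability T R)
    (mu : {sigma_finite_measure set T -> \bar R}) (c : R) :
  mu setT < +oo ->
  (forall A, measurable A -> Q A <= c%:E * mu A) ->
  {ae mu, forall x, 0 <= density Q mu x <= c%:E}.
Proof.
move=> mufin Qmu.
have dom : Q `<< mu.
  apply/null_content_dominatesP => A mA muA0; apply/eqP.
  rewrite eq_le; apply/andP; split; last exact: measure_ge0.
  by have := Qmu A mA; rewrite muA0 mule0.
have intf : mu.-integrable setT (density Q mu) by exact: Radon_Nikodym_integrable.
have intc : mu.-integrable setT (cst c%:E).
  apply/integrableP; split=> //.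
  by rewrite (integral_cst mu measurableT `|c%:E|) lte_mul_pinfty.
have f_ge0 : {ae mu, forall x, 0 <= density Q mu x}.
  apply: (le_integral_ae_le (cst 0)) => // [|A mA]; first exact: integrable0.
  by rewrite integral0 integral_density// measure_ge0.
have f_le : {ae mu, forall x, density Q mu x <= c%:E}.
  by apply: le_integral_ae_le => // A mA; rewrite integral_cst// integral_density// Qmu.
by apply: filterS2 f_ge0 f_le => x /= -> ->.
Qed.

(** * Projections of product measures *)

Definition boxes {d : measure_display} (T : measurableType d) (n : nat) :
    set (set (n.-tuple T)) :=
  [set B | exists2 A : 'I_n -> set T, (forall i, measurable (A i)) &
    B = [set t | forall i, A i (tnth t i)]].

(** Each condition [t_i \in A] is a box, and each box is a finite
    intersection of such conditions. *)
Lemma measurable_boxes {d : measure_display} (T : measurableType d) (n : nat) :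
  @measurable _ (n.-tuple T) = <<s boxes T n >>.
Proof.
apply/seteqP; split.
  apply: smallest_sub; first exact: smallest_sigma_algebra.
  elim/big_ind: _ => [//|S1 S2 S1B S2B|i _ _ [A mA <-]].
    by rewrite subUset.
  apply: sub_sigma_algebra.
  exists (fun j => if j == i then A else setT).
    by move=> j; case: ifP.
  rewrite setTI; apply/seteqP; split => [t At j|t /(_ i)]/=.
    by case: eqP => // ->.
  by rewrite eqxx.
apply: smallest_sub; first exact: sigma_algebra_measurable.
move=> _ [A mA ->].
rewrite (_ : mkset _ = \bigcap_(i in setT) ((@tnth n T)^~ i @^-1` A i)).
  apply: fin_bigcap_measurable => // i _.
  by rewrite -[X in measurable X]setTI; exact: measurable_tnth.
by apply/seteqP; split => t /= h i; [move=> _|]; exact: h.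
Qed.

Lemma setI_closed_boxes {d : measure_display} (T : measurableType d) (n : nat) :
  setI_closed (boxes T n).
Proof.
move=> _ _ [A mA ->] [B mB ->]; exists (fun i => A i `&` B i).
  by move=> i; exact: measurableI.
by apply/seteqP; split=> [t [At Bt] i|t ABt]; split=> // i; have [] := ABt i.
Qed.

Section projection.
Context {d : measure_display} {T : measurableType d} {R : realType} {p : nat}.
Variable nu : 'I_p -> {sigma_finite_measure set T -> \bar R}.

Lemma product_measure_tupleT :
  product_measure_tuple nu setT = \prod_(i < p) nu i setT.
Proof.
rewrite -(product_measure_tupleE nu (A := fun=> setT))//.
by congr (product_measure_tuple nu _); apply/seteqP; split.
Qed.

Lemma prod_mass_setC (u : {set 'I_p}) :
  \prod_(i < p) nu i setT =
  (\prod_(i in u) nu i setT) * \prod_(i in (~: u)%SET) nu i setT.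
Proof.
rewrite (bigID (mem u))/=; congr (_ * _).
by apply: eq_bigl => i; rewrite inE.
Qed.

Hypothesis nu_fin : forall i, nu i setT < +oo.

Lemma prod_mass_fin_num (P : pred 'I_p) :
  \prod_(i | P i) nu i setT \is a fin_num.
Proof. by apply: prode_fin_num => i _; rewrite ge0_fin_numE. Qed.

(** The preimage of a box by a projection is the box with the full space in the
    missing coordinates. *)
Lemma product_measure_coords_box (u : {set 'I_p}) (A : 'I_#|u| -> set T) :
  (forall i, measurable (A i)) ->
  product_measure_tuple nu
    (coords u @^-1` [set t | forall i, A i (tnth t i)]) =
  (\prod_(i in (~: u)%SET) nu i setT) *
  \prod_(i < #|u|) nu (enum_val i) (A i).
Proof.
move=> mA.
(* For [l \in u] exactly one [i] enumerates [l]; for [l \notin u] the condition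
   is vacuous, so one formula covers both cases. *)
pose B l := [set y | forall i : 'I_#|u|, enum_val i = l -> A i y].
have BA i : B (enum_val i) = A i.
  by apply/seteqP; split=> [y|y Ay j /enum_val_inj -> //]; exact.
have BT l : l \in (~: u)%SET -> B l = setT.
  rewrite inE => lu; apply/seteqP; split=> // y _ i il.
  by move: lu; rewrite -il enum_valP.
have mB l : measurable (B l).
  have [lu|lu] := boolP (l \in u); last by rewrite BT// inE.
  by rewrite -(enum_rankK_in lu lu) BA.
rewrite (_ : _ @^-1` _ = [set x | forall l, B l (tnth x l)]); last first.
  apply/seteqP; split=> x /= h => [l i <-|i].
    by have := h i; rewrite tnth_mktuple.
  by rewrite tnth_mktuple -BA; exact: h.
rewrite product_measure_tupleE// (bigID (mem u))/= muleC; congr (_ * _).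
  rewrite (eq_bigl (mem (~: u)%SET)) => [|i]; last by rewrite !inE.
  by apply: eq_bigr => i /BT ->.
by rewrite big_enum_val; apply: eq_bigr => i _; rewrite BA.
Qed.

(** Both sides are finite measures that agree on boxes, a family stable under
    intersection that generates the product sigma-algebra. *)
Lemma product_measure_coords (u : {set 'I_p}) (A : set (#|u|.-tuple T)) :
  measurable A ->
  product_measure_tuple nu (coords u @^-1` A) =
  (\prod_(i in (~: u)%SET) nu i setT) *
  product_measure_tuple (fun i : 'I_#|u| => nu (enum_val i)) A.
Proof.
move=> mA.
have V_ge0 : 0 <= \prod_(i in (~: u)%SET) nu i setT.
  by apply: prode_ge0 => i _; exact: measure_ge0.
have V_fin : \prod_(i in (~: u)%SET) nu i setT \is a fin_num.
  exact: prod_mass_fin_num.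
pose v : {nonneg R} := NngNum (fine_ge0 V_ge0).
have vE : v%:num%:E = \prod_(i in (~: u)%SET) nu i setT by rewrite /= fineK.
rewrite -vE.
pose m2 : {measure set _ -> \bar R} :=
  mscale v (product_measure_tuple (fun i : 'I_#|u| => nu (enum_val i))).
(* The canonical measure structure on a pushforward awaits a proof that the
   map is measurable. *)
pose push : {measure set _ -> \bar R} :=
  pushforward (product_measure_tuple nu) (coords u).
pose m1 := push (@measurable_coords _ _ _ u).
suff : m1 A = m2 A by [].
apply: (measure_unique (boxes T #|u|) (fun=> setT)) mA => //.
- exact: measurable_boxes.
- exact: setI_closed_boxes.
- by exists (fun=> setT) => //; apply/seteqP; split.
- by rewrite bigcup_const.
- move=> _ [B mB ->]; rewrite /m1 /m2 /push /= /pushforward /= /mscale vE.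
  rewrite product_measure_coords_box//; congr (_ * _).
  exact/esym/product_measure_tupleE.
- move=> _; rewrite /m1 /push/= /pushforward preimage_setT product_measure_tupleT.
  by rewrite ltey_eq prod_mass_fin_num.
Qed.

(** By [product_measure_coords], the preimage of a null set by a projection is
    null. *)
Lemma ae_coords (u : {set 'I_p}) (C : #|u|.-tuple T -> Prop) :
  {ae product_measure_tuple (fun i : 'I_#|u| => nu (enum_val i)),
    forall y, C y} ->
  {ae product_measure_tuple nu, forall x, C (coords u x)}.
Proof.
move=> [N [mN N0 CN]]; exists (coords u @^-1` N); split.
- by rewrite -[X in measurable X]setTI; exact: measurable_coords.
- by rewrite product_measure_coords// N0 mule0.
- by move=> x /CN.
Qed.

End projection.

(** * Marginal densities *)

(** An infinite factor can only disappear from a product if another factor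
    vanishes, since [0 * +oo = 0]. *)
Lemma prode_factors_lty {R : realType} {I : finType} (f : I -> \bar R) :
  (forall i, 0 <= f i) -> \prod_i f i != 0 -> \prod_i f i < +oo ->
  forall i, f i < +oo.
Proof.
move=> f0 fn0 foo i; move: fn0 foo; rewrite (bigD1 i)//=.
rewrite mule_eq0 negb_or => /andP[_ rest0].
case: (f i) (f0 i) => [r||]//= _; first by rewrite ltry.
by rewrite gt0_mulye// lt0e rest0 prode_ge0.
Qed.

(** [X_u] lies in [A] exactly when [X] lies in the cylinder over [A], whose mass
    is that of [A] times the masses of the missing factors; so the law of [X_u]
    inherits the bound on the law of [X]. *)
Lemma marginal_density_bounds {d : measure_display} {Omega : measurableType d}
    {R : realType} {P : probability Omega R} {p : nat}
    (X : {RV P >-> p.-tuple (measurableTypeR R)})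
    (nu : 'I_p -> {sigma_finite_measure set (measurableTypeR R) -> \bar R})
    (c : R) (u : {set 'I_p}) :
  (forall i, nu i setT < +oo) ->
  (forall A, measurable A ->
    distribution P X A <= c%:E * product_measure_tuple nu A) ->
  {ae product_measure_tuple nu, forall x,
    0 <= marginal_density X nu u (coords u x)
      <= c%:E * \prod_(i in (~: u)%SET) nu i setT}.
Proof.
move=> nu_fin Xle.
rewrite -(fineK (prod_mass_fin_num nu nu_fin (mem (~: u)%SET))) -EFinM.
apply: (ae_coords nu nu_fin u (fun y => 0 <= marginal_density X nu u y <= _)).
apply: ae_density_bounds => [|A mA].
  rewrite /marginal_measure product_measure_tupleT ltey_eq prode_fin_num//.
  by move=> i _; rewrite ge0_fin_numE.
rewrite EFinM fineK ?prod_mass_fin_num// -muleA -product_measure_coords//.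
apply: Xle; rewrite -[X in measurable X]setTI; exact: measurable_coords.
Qed.

Theorem proposition3 (R : realType) (d : measure_display)
    (Omega : measurableType d) (P : probability Omega R)
    (p : nat) (hp : (1 <= p)%N)
    (X : {RV P >-> p.-tuple (measurableTypeR R)})
    (nu_ : 'I_p -> {sigma_finite_measure set (measurableTypeR R) -> \bar R})
    (nu := product_measure_tuple nu_)
    (hX : distribution P X `<< nu)
    (pX := density (distribution P X) nu)
    (M1 M2 : R) (hM1 : (0 < M1)%R) (hM2 : (0 < M2)%R)
    (hpX : {ae nu, forall x, M1%:E <= pX x <= M2%:E}) :
  exists2 M : R, (0 < M <= 1)%R &
    forall u : {set 'I_p},
      {ae nu, forall x,
        M%:E * (marginal_density X nu_ u (coords u x)
                * marginal_density X nu_ (~: u)%SET (coords (~: u)%SET x))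
        <= pX x}.
Proof.
have Xle A : measurable A -> distribution P X A <= M2%:E * nu A.
  apply: probability_le_of_density_le => //; first exact: ltW.
  apply: filterS hpX => x /andP[M1x ->]; rewrite andbT.
  by apply: le_trans M1x; rewrite lee_fin ltW.
have nu_lty : nu setT < +oo.
  apply: (density_bounded_below_lty (distribution P X) nu M1) => //.
  by apply: filterS hpX => x /andP[].
have nu_neq0 : nu setT != 0.
  apply/eqP => nu0; have := Xle setT measurableT.
  by rewrite nu0 mule0 probability_setT lee_fin ler10.
have nuE : nu setT = \prod_i nu_ i setT by exact: product_measure_tupleT.
have nu_fin i : nu_ i setT < +oo.
  by apply: (prode_factors_lty (fun i => nu_ i setT)) => //; rewrite -nuE.
pose V := fine (nu setT).
have VE : nu setT = V%:E by rewrite fineK// ge0_fin_numE.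
have V_gt0 : (0 < V)%R by rewrite -lte_fin -VE lt0e nu_neq0 measure_ge0.
have K_gt0 : (0 < M2 ^+ 2 * V)%R by rewrite mulr_gt0// exprn_gt0.
pose M := Num.min 1%R (M1 / (M2 ^+ 2 * V))%R.
have M_gt0 : (0 < M)%R by rewrite lt_min ltr01 divr_gt0.
exists M; first by rewrite M_gt0 ge_min lexx.
move=> u.
have := marginal_density_bounds X nu_ M2 u nu_fin Xle.
have := marginal_density_bounds X nu_ M2 (~: u)%SET nu_fin Xle.
apply: (filterS3 _ _ hpX) => x /andP[M1x _] /andP[q0 qle] /andP[r0 rle].
apply: le_trans M1x; apply: (@le_trans _ _ (M%:E * (M2 ^+ 2 * V)%:E)).
  rewrite lee_pmul2l//; apply: (le_trans (lee_pmul r0 q0 rle qle)).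
  (* [(M2 * V_(~: u)) * (M2 * V_u) = M2 ^+ 2 * V] *)
  rewrite finset.setCK muleACA [X in _ * X]muleC -prod_mass_setC -nuE VE.
  by rewrite -!EFinM expr2.
by rewrite -EFinM lee_fin -ler_pdivlMr// ge_min lexx orbT.
Qed.
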